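(* Let $c>0$ be fixed. For $k\in\left(\frac{\sqrt c}{3},\frac{\sqrt{3c}}{3}\right)$ let $\phi=\phi(\cdot;k)$ be the smooth even solitary wave profile of the modified Camassa-Holm equation with speed $c$ and background $k$, and set $$Q(\phi,k)=\int_{\mathbb R}\left(\sqrt{\frac{c-k^2}{c+3k^2-4k\phi}}+\sqrt{\frac{c+3k^2-4k\phi}{c-k^2}}-2\right)d\xi .$$ Then $$\frac{d}{dk}Q(\phi,k)<0\qquad\text{for every }k\in\left(\frac{\sqrt c}{3},\frac{\sqrt{3c}}{3}\right).$$
   Context: The modified Camassa-Holm equation is $m_t+((u^2-u_x^2)m)_x=0$, $m=u-u_{xx}$. For $c>0$ and $k\in\left(\frac{\sqrt c}{3},\frac{\sqrt{3c}}{3}\right)$, the solitary wave profile $\phi$ is the unique nonconstant even $C^\infty(\mathbb R)$ solution of $(\phi-\phi_{\xi\xi})(\phi_\xi^2-\phi^2+c)=k(c-k^2)$ (travelling wave $u(t,x)=\phi(\xi)$, $\xi=x-ct$) with $\phi(\xi)\to k$ and $\phi_\xi(\xi)\to0$ as $|\xi|\to\infty$. It satisfies $k<\phi\le\sqrt{2(c-k^2)}-k<\sqrt c$. The rescaled profile $\varphi$ defined by $\phi=k+\frac{c-k^2}{4k}\varphi$ takes values in $(0,1)$, so $c+3k^2-4k\phi=(c-k^2)(1-\varphi)>0$. The derivative $\frac{d}{dk}$ is the total derivative in $k$ at fixed $c$, including the dependence of $\phi$ on $k$. *)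

(* Defs.v *)
From Stdlib Require Import Reals.
From Coquelicot Require Import Coquelicot.
Open Scope R_scope.

Record solitary_wave_profile (c k : R) (f : R -> R) : Prop := {
  profile_smooth : forall (n : nat) (x : R), ex_derive_n f n x;
  profile_even : forall x : R, f (- x) = f x;
  profile_nonconstant : ~ exists a : R, forall x : R, f x = a;
  profile_equation : forall x : R,
    (f x - Derive_n f 2 x) * ((Derive f x) ^ 2 - (f x) ^ 2 + c)
    = k * (c - k ^ 2);
  profile_lim_p : is_lim f p_infty k;
  profile_lim_m : is_lim f m_infty k;
  profile_deriv_lim_p : is_lim (Derive f) p_infty 0;
  profile_deriv_lim_m : is_lim (Derive f) m_infty 0
}.

Definition background_range (c k : R) : Prop :=
  sqrt c / 3 < k < sqrt (3 * c) / 3.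

Definition Q_integrand (c k : R) (f : R -> R) (xi : R) : R :=
  sqrt ((c - k ^ 2) / (c + 3 * k ^ 2 - 4 * k * f xi))
  + sqrt ((c + 3 * k ^ 2 - 4 * k * f xi) / (c - k ^ 2))
  - 2.

(* RInt_gen is only meaningful where the improper integral converges, hence
   the separate convergence predicate. *)
Definition Q_converges (c k : R) (f : R -> R) : Prop :=
  ex_RInt_gen (Q_integrand c k f) (Rbar_locally m_infty) (Rbar_locally p_infty).

Definition Q (c k : R) (f : R -> R) : R :=
  RInt_gen (Q_integrand c k f) (Rbar_locally m_infty) (Rbar_locally p_infty).

(* Main.v *)
Require Import Defs.
From Stdlib Require Import Reals Lra.
From Coquelicot Require Import Coquelicot.
Open Scope R_scope.

(** [Q] has a closed form, obtained by unfolding the homoclinic orbit of the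
    profile [f] onto an interval.

    Put [s = (f'^2 - f^2 + c) / (c - k^2)] ([flux_ratio]).  The profile equation
    says [(f - f'') s = k], and it has the first integral
    [s^2 = (c + 3k^2 - 4kf) / (c - k^2)]; hence [s] is the second square root in
    the integrand of [Q], and the integrand is [1/s + s - 2 = (1 - s)^2 / s].
    Eliminating [f] gives, with [a^2 = 8k^2 / (c - k^2)],
    [s'^2 = ((1 - s) / (2s))^2 ((1 + s)^2 - a^2)].
    The second factor vanishes at the crest, where a square root would not be
    smooth, so it is replaced by [w = 2 s s' / (1 - s)] ([unfolded_slope]), a
    signed smooth square root of it: [w^2 = (1 + s)^2 - a^2] and
    [w' = (1 - s^2) / (2s)].  Since [0 < s < 1], [w] increases, through [0] at
    the crest, from [-W] to [W], where [W^2 = 4 - a^2] ([end_slope]).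
    Along the orbit the integrand is [2 (2 / (1 + s) - 1) w'] with
    [1 + s = sqrt (w^2 + a^2)], and so it is the derivative of
    [4 ln (1 + s + w) - 2 w] ([is_derive_Q_primitive]).  Therefore
    [Q = 4 ln ((2 + W) / (2 - W)) - 4 W] ([is_RInt_gen_Q_integrand]).

    This function of [W] has derivative [4 W^2 / (4 - W^2) > 0], while
    [W^2 = 4 (c - 3k^2) / (c - k^2)] decreases in [k]; the chain rule concludes.

    Two facts about the orbit need an argument: [s > 0] ([flux_ratio_pos]) and
    [s < 1] ([flux_ratio_lt_1]).  Both quantities [s] and [1 - s] are continuous
    and have no zero, so one point fixes their sign: a point near infinity for
    [s], the crest for [1 - s].  That [1 - s] has no zero is uniqueness for the
    equilibrium [f = k] ([profile_ne_background]). *)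

(** * Calculus on the real line *)

Lemma continuous_of_ex_derive (h : R -> R) (x : R) :
  ex_derive h x -> continuous h x.
Proof. exact (@ex_derive_continuous R_AbsRing R_NormedModule h x). Qed.

(** The form in which the derivative of a factor appears in the goals of
    [auto_derive]. *)
Lemma Derive_eta (h : R -> R) (x l : R) :
  is_derive h x l -> Derive (fun t : R => h t) x = l.
Proof. exact (is_derive_unique h x l). Qed.

Lemma positive_of_nonvanishing (h : R -> R) (a : R) :
  (forall x, continuous h x) -> (forall x, h x <> 0) -> 0 < h a ->
  forall x, 0 < h x.
Proof.
  intros hcont hnz ha x.
  destruct (Rlt_le_dec 0 (h x)) as [hx | hx]; [exact hx | exfalso].
  destruct (IVT_gen h a x 0) as [z [_ hz]].
  - intros y. apply continuity_pt_filterlim, hcont.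
  - rewrite Rmin_right, Rmax_left by lra. lra.
  - exact (hnz z hz).
Qed.

Lemma mean_value (h dh : R -> R) (a b : R) :
  (forall x, is_derive h x (dh x)) ->
  exists z, Rmin a b <= z <= Rmax a b /\ h b - h a = dh z * (b - a).
Proof.
  intros hder. apply MVT_gen.
  - intros x _. apply hder.
  - intros x _. apply continuity_pt_filterlim, continuous_of_ex_derive.
    exists (dh x). apply hder.
Qed.

(** Gronwall: [h^2 exp (-2t)] is nonincreasing and [h^2 exp (2t)] is
    nondecreasing, and both vanish at [a].  This is the uniqueness of an
    equilibrium without any appeal to existence theory. *)
Lemma zero_of_self_bounded_derivative (h dh : R -> R) (a : R) :
  (forall x, is_derive h x (dh x)) -> (forall x, Rabs (dh x) <= Rabs (h x)) ->
  h a = 0 -> forall x, h x = 0.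
Proof.
  intros hder hbound ha x.
  assert (hprod : forall y, - (h y)^2 <= h y * dh y <= (h y)^2).
  { intros y. apply Rabs_le_between. rewrite Rabs_mult, <- (pow2_abs (h y)).
    pose proof (Rabs_pos (h y)). specialize (hbound y). nra. }
  assert (hweight : forall lam y,
    is_derive (fun t => (h t)^2 * exp (lam * t)) y
      ((2 * (h y * dh y) + lam * (h y)^2) * exp (lam * y))).
  { intros lam y. auto_derive.
    - exists (dh y). apply hder.
    - rewrite (Derive_eta _ _ _ (hder y)). ring. }
  assert (hsq : (h x)^2 <= 0).
  { destruct (Rle_lt_dec a x) as [hax | hxa].
    - destruct (mean_value _ _ a x (hweight (-2))) as [z [_ hz]].
      cbv beta in hz. rewrite ha in hz. specialize (hprod z).
      pose proof (exp_pos (-2 * z)). pose proof (exp_pos (-2 * x)).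
      assert (0 <= (-2 * (h z * dh z) + 2 * (h z)^2) * exp (-2 * z) * (x - a))
        by (apply Rmult_le_pos; [apply Rmult_le_pos|]; lra).
      assert ((h x)^2 * exp (-2 * x) <= 0) by lra.
      nra.
    - destruct (mean_value _ _ a x (hweight 2)) as [z [_ hz]].
      cbv beta in hz. rewrite ha in hz. specialize (hprod z).
      pose proof (exp_pos (2 * z)). pose proof (exp_pos (2 * x)).
      assert (0 <= (2 * (h z * dh z) + 2 * (h z)^2) * exp (2 * z) * (a - x))
        by (apply Rmult_le_pos; [apply Rmult_le_pos|]; lra).
      assert ((h x)^2 * exp (2 * x) <= 0) by lra.
      nra. }
  nra.
Qed.

Lemma is_RInt_gen_antiderivative (F f : R -> R) (lm lp : R) :
  (forall x, is_derive F x (f x)) -> (forall x, continuous f x) ->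
  is_lim F m_infty lm -> is_lim F p_infty lp ->
  is_RInt_gen f (Rbar_locally m_infty) (Rbar_locally p_infty) (lp - lm).
Proof.
  intros hder hcont hm hp.
  apply (is_RInt_gen_ext (Derive F)).
  { apply filter_forall. intros ab x _. apply is_derive_unique, hder. }
  apply is_RInt_gen_Derive; try exact hm; try exact hp;
    apply filter_forall; intros ab x _.
  - exists (f x). apply hder.
  - apply (continuous_ext f); [|apply hcont].
    intros y. symmetry. apply is_derive_unique, hder.
Qed.

(** * The first integral *)

Lemma background_range_bounds (c k : R) :
  0 < c -> background_range c k -> 0 < k /\ 0 < c - 3 * k^2 /\ 0 < c - k^2.
Proof.
  intros hc [hl hu].
  pose proof (sqrt_lt_R0 c hc) as hs.
  assert (hk : 0 < k) by lra.
  assert (h3 : (3 * k)^2 < 3 * c).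
  { rewrite <- (pow2_sqrt (3 * c)) by lra. nra. }
  nra.
Qed.

Lemma background_range_open (c k : R) :
  background_range c k -> locally k (background_range c).
Proof.
  intros [hl hu].
  exact (open_and _ _ (open_gt (sqrt c / 3)) (open_lt (sqrt (3 * c) / 3)) k
           (conj hl hu)).
Qed.

(** The quantity [s] of the introduction: it tends to [1] at infinity. *)
Definition flux_ratio (c k : R) (f : R -> R) (x : R) : R :=
  ((Derive f x)^2 - (f x)^2 + c) / (c - k^2).

Lemma profile_is_derive c k f x :
  solitary_wave_profile c k f -> is_derive f x (Derive f x).
Proof.
  intros hf. apply Derive_correct. exact (profile_smooth _ _ _ hf 1%nat x).
Qed.

Lemma profile_is_derive_2 c k f x :
  solitary_wave_profile c k f -> is_derive (Derive f) x (Derive_n f 2 x).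
Proof.
  intros hf. apply (Derive_correct (Derive f)).
  exact (profile_smooth _ _ _ hf 2%nat x).
Qed.

Lemma flux_ratio_equation c k f x : 0 < c - k^2 ->
  solitary_wave_profile c k f ->
  (f x - Derive_n f 2 x) * flux_ratio c k f x = k.
Proof.
  intros hb hf. pose proof (profile_equation _ _ _ hf x) as heq.
  unfold flux_ratio.
  replace ((f x - Derive_n f 2 x) * (((Derive f x)^2 - (f x)^2 + c) / (c - k^2)))
    with ((f x - Derive_n f 2 x) * ((Derive f x)^2 - (f x)^2 + c) / (c - k^2))
    by (field; lra).
  rewrite heq. field. lra.
Qed.

Lemma is_derive_flux_ratio_of_profile c k f x : 0 < c - k^2 ->
  solitary_wave_profile c k f ->
  is_derive (flux_ratio c k f) x
    (- 2 * Derive f x * (f x - Derive_n f 2 x) / (c - k^2)).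
Proof.
  intros hb hf. unfold flux_ratio.
  pose proof (profile_is_derive _ _ _ x hf) as h1.
  pose proof (profile_is_derive_2 _ _ _ x hf) as h2.
  auto_derive.
  - repeat split; [eexists; exact h2 | eexists; exact h1].
  - rewrite (Derive_eta _ _ _ h2).
    change (Derive (fun x => f x) x) with (Derive f x). field. lra.
Qed.

Lemma is_lim_flux_ratio c k f (e : Rbar) : 0 < c - k^2 ->
  is_lim f e k -> is_lim (Derive f) e 0 -> is_lim (flux_ratio c k f) e 1.
Proof.
  intros hb h0 h1. unfold flux_ratio.
  replace 1 with ((0^2 + (c - k^2)) / (c - k^2)) by (field; lra).
  apply (is_lim_ext (fun x => ((Derive f x)^2 + (c - (f x)^2)) / (c - k^2))).
  { intros x. f_equal. ring. }
  apply (is_lim_comp_continuous (fun x => (Derive f x)^2 + (c - (f x)^2))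
           (fun y => y / (c - k^2))).
  2: { apply continuous_of_ex_derive; auto_derive; easy. }
  apply is_lim_plus'.
  - apply (is_lim_comp_continuous (Derive f) (fun y => y^2)); [exact h1|].
    apply continuous_of_ex_derive; auto_derive; easy.
  - apply (is_lim_comp_continuous f (fun y => c - y^2)); [exact h0|].
    apply continuous_of_ex_derive; auto_derive; easy.
Qed.

(** [(f'^2 - f^2 + c)' = -2 f' (f - f'')], so multiplying by [s] and using
    [(f - f'') s = k] shows that [s^2 + 4 k f / (c - k^2)] is constant; the
    behaviour at infinity gives the constant. *)
Lemma flux_ratio_sqr c k f x : 0 < c - k^2 -> solitary_wave_profile c k f ->
  (flux_ratio c k f x)^2 = (c + 3 * k^2 - 4 * k * f x) / (c - k^2).
Proof.
  intros hb hf.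
  set (E := fun y => (flux_ratio c k f y)^2 + 4 * k / (c - k^2) * f y).
  assert (hE : forall y, is_derive E y 0).
  { intros y. pose proof (is_derive_flux_ratio_of_profile _ _ _ y hb hf) as hs.
    pose proof (profile_is_derive _ _ _ y hf) as h1.
    pose proof (flux_ratio_equation _ _ _ y hb hf) as heq.
    unfold E. auto_derive.
    - repeat split; eexists; eassumption.
    - rewrite (Derive_eta _ _ _ hs).
      change (Derive (fun x => f x) y) with (Derive f y).
      transitivity (4 * Derive f y / (c - k^2)
                    * (k - (f y - Derive_n f 2 y) * flux_ratio c k f y)).
      + field. lra.
      + rewrite heq. ring. }
  assert (hconst : forall y, E y = E x).
  { intros y. destruct (mean_value E (fun _ => 0) x y hE) as [z [_ hz]]. lra. }
  assert (hlim : is_lim E p_infty (1^2 + 4 * k / (c - k^2) * k)).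
  { apply is_lim_plus'.
    - apply (is_lim_comp_continuous (flux_ratio c k f) (fun y => y^2)).
      + apply is_lim_flux_ratio; [exact hb | apply hf | apply hf].
      + apply continuous_of_ex_derive; auto_derive; easy.
    - apply (is_lim_comp_continuous f (fun y => 4 * k / (c - k^2) * y)).
      + apply hf.
      + apply continuous_of_ex_derive; auto_derive; easy. }
  apply (is_lim_ext _ (fun _ => E x)) in hlim; [|exact hconst].
  apply is_lim_unique in hlim. rewrite Lim_const in hlim.
  assert (hval : E x = 1^2 + 4 * k / (c - k^2) * k) by congruence.
  unfold E in hval.
  replace ((c + 3 * k^2 - 4 * k * f x) / (c - k^2))
    with (1^2 + 4 * k / (c - k^2) * k - 4 * k / (c - k^2) * f x)
    by (field; lra).
  lra.
Qed.

Lemma flux_ratio_continuous c k f x : 0 < c - k^2 ->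
  solitary_wave_profile c k f -> continuous (flux_ratio c k f) x.
Proof.
  intros hb hf. apply continuous_of_ex_derive.
  eexists. apply is_derive_flux_ratio_of_profile; assumption.
Qed.

(** The profile equation forbids zeros of [s] because [k <> 0], and [s] is
    positive near infinity. *)
Lemma flux_ratio_pos c k f x : 0 < k -> 0 < c - k^2 ->
  solitary_wave_profile c k f -> 0 < flux_ratio c k f x.
Proof.
  intros hk hb hf.
  pose proof (is_lim_flux_ratio c k f p_infty hb (profile_lim_p _ _ _ hf)
                (profile_deriv_lim_p _ _ _ hf)) as hlim.
  destruct (hlim (fun y => 0 < y)) as [M hM].
  { apply (open_gt 0). lra. }
  apply (positive_of_nonvanishing _ (M + 1)).
  - intros y. apply flux_ratio_continuous; assumption.
  - intros y hy. pose proof (flux_ratio_equation _ _ _ y hb hf) as heq.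
    rewrite hy in heq. lra.
  - apply hM. lra.
Qed.

Lemma profile_of_flux_ratio c k f x : 0 < k -> 0 < c - k^2 ->
  solitary_wave_profile c k f ->
  f x = k + (c - k^2) * (1 - (flux_ratio c k f x)^2) / (4 * k).
Proof.
  intros hk hb hf. rewrite (flux_ratio_sqr _ _ _ _ hb hf). field. lra.
Qed.

(** The first integral as an equation of order one, factored so as to show the
    double zero at the equilibrium [s = 1]. *)
Lemma profile_slope_sqr c k f x : 0 < k -> 0 < c - k^2 ->
  solitary_wave_profile c k f ->
  (Derive f x)^2 = ((c - k^2) / (4 * k) * (1 - flux_ratio c k f x))^2
    * ((1 + flux_ratio c k f x)^2 - 8 * k^2 / (c - k^2)).
Proof.
  intros hk hb hf.
  pose proof (profile_of_flux_ratio _ _ _ x hk hb hf) as hfx.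
  assert (hslope : (Derive f x)^2
    = (f x)^2 - c + (c - k^2) * flux_ratio c k f x)
    by (unfold flux_ratio; field; lra).
  rewrite hslope, hfx. field. lra.
Qed.

(** The first-order equation gives [|f'| <= |f - k|] with constant exactly [1],
    since [f - k] is [(c - k^2) / (4k) (1 - s) (1 + s)] and dropping [a^2] only
    increases the right-hand side.  A profile meeting [k] would be constant. *)
Lemma profile_ne_background c k f x : 0 < k -> 0 < c - k^2 ->
  solitary_wave_profile c k f -> f x <> k.
Proof.
  intros hk hb hf hx. apply (profile_nonconstant _ _ _ hf). exists k. intros y.
  cut (f y - k = 0); [lra|].
  apply (zero_of_self_bounded_derivative (fun t => f t - k) (Derive f) x).
  - intros t. pose proof (profile_is_derive _ _ _ t hf) as ht.
    auto_derive; [eexists; exact ht|].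
    change (Derive (fun x => f x) t) with (Derive f t). ring.
  - intros t. apply Rsqr_le_abs_0. rewrite !Rsqr_pow2.
    rewrite (profile_slope_sqr _ _ _ t hk hb hf).
    rewrite (profile_of_flux_ratio _ _ _ t hk hb hf).
    set (s := flux_ratio c k f t).
    assert (hpos : 0 <= ((c - k^2) / (4 * k) * (1 - s))^2 * (8 * k^2 / (c - k^2))).
    { apply Rmult_le_pos; [apply pow2_ge_0|].
      apply Rdiv_le_0_compat; [nra | exact hb]. }
    replace ((k + (c - k^2) * (1 - s^2) / (4 * k) - k)^2)
      with (((c - k^2) / (4 * k) * (1 - s))^2 * (1 + s)^2) by (field; lra).
    lra.
  - simpl. lra.
Qed.

Lemma profile_slope_at_crest c k f :
  solitary_wave_profile c k f -> Derive f 0 = 0.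
Proof.
  intros hf. pose proof (profile_is_derive _ _ _ 0 hf) as h0.
  assert (hopp : is_derive f 0 (- Derive f 0)).
  { apply (is_derive_ext (fun x => f (- x))); [apply hf|].
    rewrite <- Ropp_0 in h0 at 1.
    auto_derive; [eexists; exact h0|].
    change (fun x => f x) with f. rewrite Ropp_0. ring. }
  apply is_derive_unique in hopp. lra.
Qed.

(** At the crest [f' = 0] and [s <> 1], so the other factor of the first-order
    equation vanishes there: [1 + s = a < 2]. *)
Lemma flux_ratio_lt_1 c k f x : 0 < k -> 0 < c - 3 * k^2 -> 0 < c - k^2 ->
  solitary_wave_profile c k f -> flux_ratio c k f x < 1.
Proof.
  intros hk h3 hb hf.
  assert (hne : forall y, 1 - flux_ratio c k f y <> 0).
  { intros y hy. apply (profile_ne_background _ _ _ y hk hb hf).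
    rewrite (profile_of_flux_ratio _ _ _ y hk hb hf).
    replace (flux_ratio c k f y) with 1 by lra. field. lra. }
  cut (0 < 1 - flux_ratio c k f x); [lra|].
  apply (positive_of_nonvanishing (fun y => 1 - flux_ratio c k f y) 0).
  - intros y. pose proof (is_derive_flux_ratio_of_profile _ _ _ y hb hf) as hs.
    apply continuous_of_ex_derive.
    auto_derive. eexists; exact hs.
  - exact hne.
  - pose proof (profile_slope_sqr _ _ _ 0 hk hb hf) as hslope.
    rewrite (profile_slope_at_crest _ _ _ hf) in hslope.
    pose proof (flux_ratio_pos _ _ _ 0 hk hb hf) as hs0.
    specialize (hne 0). revert hslope hs0 hne.
    generalize (flux_ratio c k f 0). intros s hslope hs0 hne.
    assert (hcoef : 0 < ((c - k^2) / (4 * k) * (1 - s))^2).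
    { apply pow2_gt_0. apply Rmult_integral_contrapositive_currified; [|exact hne].
      apply Rgt_not_eq, Rdiv_lt_0_compat; lra. }
    assert (ha : 8 * k^2 / (c - k^2) < 4).
    { apply Rlt_div_l; lra. }
    destruct (Rmult_integral _ _ (eq_trans (eq_sym hslope) (pow_i 2 Nat.lt_0_2)));
      nra.
Qed.

(** * Unfolding the homoclinic orbit *)

(** By [is_derive_flux_ratio] this is [w = 2 s s' / (1 - s)].  Defining it from
    [f'] makes its differentiability and its zero at the crest immediate. *)
Definition unfolded_slope (c k : R) (f : R -> R) (x : R) : R :=
  - (4 * k * Derive f x) / ((c - k^2) * (1 - flux_ratio c k f x)).

Lemma is_derive_flux_ratio c k f x : 0 < k -> 0 < c - 3 * k^2 -> 0 < c - k^2 ->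
  solitary_wave_profile c k f ->
  is_derive (flux_ratio c k f) x
    (unfolded_slope c k f x * (1 - flux_ratio c k f x)
       / (2 * flux_ratio c k f x)).
Proof.
  intros hk h3 hb hf.
  pose proof (flux_ratio_pos _ _ _ x hk hb hf) as hs0.
  pose proof (flux_ratio_lt_1 _ _ _ x hk h3 hb hf) as hs1.
  pose proof (flux_ratio_equation _ _ _ x hb hf) as heq.
  replace (unfolded_slope c k f x * (1 - flux_ratio c k f x)
           / (2 * flux_ratio c k f x))
    with (- 2 * Derive f x * (f x - Derive_n f 2 x) / (c - k^2)).
  { apply is_derive_flux_ratio_of_profile; assumption. }
  replace (f x - Derive_n f 2 x) with (k / flux_ratio c k f x)
    by (rewrite <- heq at 1; field; lra).
  unfold unfolded_slope. field. lra.
Qed.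

Lemma unfolded_slope_sqr c k f x : 0 < k -> 0 < c - 3 * k^2 -> 0 < c - k^2 ->
  solitary_wave_profile c k f ->
  (unfolded_slope c k f x)^2
  = (1 + flux_ratio c k f x)^2 - 8 * k^2 / (c - k^2).
Proof.
  intros hk h3 hb hf.
  pose proof (flux_ratio_lt_1 _ _ _ x hk h3 hb hf) as hs1.
  pose proof (profile_slope_sqr _ _ _ x hk hb hf) as hslope.
  unfold unfolded_slope.
  transitivity ((4 * k / ((c - k^2) * (1 - flux_ratio c k f x)))^2
                * (Derive f x)^2).
  - field. lra.
  - rewrite hslope. field. lra.
Qed.

(** Differentiating [w^2 = (1 + s)^2 - a^2] would suggest this formula but leaves
    the crest [w = 0] out; hence the direct computation from the second-order
    equation, which holds everywhere. *)
Lemma is_derive_unfolded_slope c k f x :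
  0 < k -> 0 < c - 3 * k^2 -> 0 < c - k^2 -> solitary_wave_profile c k f ->
  is_derive (unfolded_slope c k f) x
    ((1 - (flux_ratio c k f x)^2) / (2 * flux_ratio c k f x)).
Proof.
  intros hk h3 hb hf.
  pose proof (flux_ratio_pos _ _ _ x hk hb hf) as hs0.
  pose proof (flux_ratio_lt_1 _ _ _ x hk h3 hb hf) as hs1.
  pose proof (is_derive_flux_ratio _ _ _ x hk h3 hb hf) as hds.
  pose proof (profile_is_derive_2 _ _ _ x hf) as h2.
  pose proof (flux_ratio_equation _ _ _ x hb hf) as heq.
  pose proof (profile_of_flux_ratio _ _ _ x hk hb hf) as hfx.
  pose proof (unfolded_slope_sqr _ _ _ x hk h3 hb hf) as hw.
  unfold unfolded_slope at 1.
  auto_derive.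
  - repeat split; [eexists; exact h2 | eexists; exact hds |].
    apply Rgt_not_eq, Rmult_lt_0_compat; lra.
  - rewrite (Derive_eta _ _ _ h2).
    rewrite (Derive_eta _ _ _ hds).
    change (Derive (fun x => f x) x) with (Derive f x).
    set (s := flux_ratio c k f x) in *. set (w := unfolded_slope c k f x) in *.
    assert (hf2 : Derive_n f 2 x
      = k + (c - k^2) * (1 - s^2) / (4 * k) - k / s).
    { rewrite <- hfx. apply (Rmult_eq_reg_r s); [|lra].
      replace ((f x - k / s) * s) with (f x * s - k) by (field; lra). lra. }
    assert (hf1 : Derive f x = - w * (c - k^2) * (1 - s) / (4 * k)).
    { unfold w, unfolded_slope. fold s. field. lra. }
    rewrite hf2, hf1.
    transitivity ((w^2 + 8 * k^2 / (c - k^2)) / (2 * s) - (1 + s)).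
    + field. lra.
    + rewrite hw. field. lra.
Qed.

(** * The value of the integral *)

Lemma Q_integrand_flux_ratio c k f x :
  0 < k -> 0 < c - k^2 -> solitary_wave_profile c k f ->
  Q_integrand c k f x
  = (1 - flux_ratio c k f x)^2 / flux_ratio c k f x.
Proof.
  intros hk hb hf.
  pose proof (flux_ratio_pos _ _ _ x hk hb hf) as hs0.
  pose proof (flux_ratio_sqr _ _ _ x hb hf) as hs2.
  unfold Q_integrand. set (s := flux_ratio c k f x) in *.
  replace ((c - k^2) / (c + 3 * k^2 - 4 * k * f x)) with ((/ s)^2).
  - rewrite <- hs2, !sqrt_pow2; [field; lra | lra |].
    left. apply Rinv_0_lt_compat, hs0.
  - replace (c + 3 * k^2 - 4 * k * f x) with ((c - k^2) * s^2).
    + field. lra.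
    + rewrite hs2. field. lra.
Qed.

(** Up to a constant, [4 arcsinh (w / a) - 2 w] in the variable [w], because
    [1 + s = sqrt (w^2 + a^2)]. *)
Definition Q_primitive (s w : R) : R := 4 * ln (1 + s + w) - 2 * w.

(** [(1 + s)^2 - w^2 = a^2 > 0] and [1 + s > 0]. *)
Lemma flux_ratio_slope_sum_pos c k f x :
  0 < k -> 0 < c - 3 * k^2 -> 0 < c - k^2 -> solitary_wave_profile c k f ->
  0 < 1 + flux_ratio c k f x + unfolded_slope c k f x.
Proof.
  intros hk h3 hb hf.
  pose proof (flux_ratio_pos _ _ _ x hk hb hf) as hs0.
  pose proof (unfolded_slope_sqr _ _ _ x hk h3 hb hf) as hw.
  assert (ha : 0 < 8 * k^2 / (c - k^2)).
  { apply Rdiv_lt_0_compat; nra. }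
  nra.
Qed.

Lemma is_derive_Q_primitive c k f x :
  0 < k -> 0 < c - 3 * k^2 -> 0 < c - k^2 -> solitary_wave_profile c k f ->
  is_derive (fun y => Q_primitive (flux_ratio c k f y) (unfolded_slope c k f y))
    x (Q_integrand c k f x).
Proof.
  intros hk h3 hb hf.
  pose proof (flux_ratio_pos _ _ _ x hk hb hf) as hs0.
  pose proof (flux_ratio_slope_sum_pos _ _ _ x hk h3 hb hf) as hsum.
  pose proof (is_derive_flux_ratio _ _ _ x hk h3 hb hf) as hds.
  pose proof (is_derive_unfolded_slope _ _ _ x hk h3 hb hf) as hdw.
  rewrite (Q_integrand_flux_ratio _ _ _ _ hk hb hf).
  unfold Q_primitive. auto_derive.
  - repeat split; first [exact hsum | eexists; eassumption].
  - rewrite (Derive_eta _ _ _ hds).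
    rewrite (Derive_eta _ _ _ hdw).
    field. lra.
Qed.

(** [w] vanishes at the crest and has positive derivative. *)
Lemma unfolded_slope_sign c k f x :
  0 < k -> 0 < c - 3 * k^2 -> 0 < c - k^2 -> solitary_wave_profile c k f ->
  x <> 0 -> 0 < x * unfolded_slope c k f x.
Proof.
  intros hk h3 hb hf hx.
  destruct (mean_value (unfolded_slope c k f) _ 0 x
              (fun y => is_derive_unfolded_slope _ _ _ y hk h3 hb hf))
    as [z [_ hz]].
  pose proof (flux_ratio_pos _ _ _ z hk hb hf) as hs0.
  pose proof (flux_ratio_lt_1 _ _ _ z hk h3 hb hf) as hs1.
  assert (hd : 0 < (1 - (flux_ratio c k f z)^2) / (2 * flux_ratio c k f z)).
  { apply Rdiv_lt_0_compat; nra. }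
  assert (h0 : unfolded_slope c k f 0 = 0).
  { unfold unfolded_slope. rewrite (profile_slope_at_crest _ _ _ hf).
    unfold Rdiv. ring. }
  rewrite h0 in hz.
  replace (unfolded_slope c k f x)
    with ((1 - (flux_ratio c k f z)^2) / (2 * flux_ratio c k f z) * x) by lra.
  pose proof (Rmult_lt_0_compat _ _ hd (pow2_gt_0 x hx)). lra.
Qed.

(** The limit of [unfolded_slope] at infinity, [sqrt (4 - a^2)] with
    [a^2 = 8k^2 / (c - k^2)]. *)
Definition end_slope (c k : R) : R := sqrt (4 * (c - 3 * k^2) / (c - k^2)).

(** The first-order relation determines the limit of [w] up to sign; the sign is
    that of [x]. *)
Lemma is_lim_sqrt_slope_sqr c k f (e : Rbar) :
  0 < k -> 0 < c - 3 * k^2 -> 0 < c - k^2 -> solitary_wave_profile c k f ->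
  is_lim (flux_ratio c k f) e 1 ->
  is_lim (fun x => sqrt ((unfolded_slope c k f x)^2)) e (end_slope c k).
Proof.
  intros hk h3 hb hf hlim. unfold end_slope.
  replace (4 * (c - 3 * k^2) / (c - k^2))
    with ((1 + 1)^2 - 8 * k^2 / (c - k^2)) by (field; lra).
  apply (is_lim_ext (fun x => sqrt ((1 + flux_ratio c k f x)^2
                                    - 8 * k^2 / (c - k^2)))).
  { intros x. f_equal. symmetry. apply unfolded_slope_sqr; assumption. }
  apply (is_lim_comp_continuous (flux_ratio c k f)
           (fun s => sqrt ((1 + s)^2 - 8 * k^2 / (c - k^2)))); [exact hlim|].
  apply continuous_of_ex_derive. auto_derive.
  assert (8 * k^2 / (c - k^2) < 4) by (apply Rlt_div_l; lra).
  simpl in *. lra.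
Qed.

Lemma is_lim_unfolded_slope_p c k f :
  0 < k -> 0 < c - 3 * k^2 -> 0 < c - k^2 -> solitary_wave_profile c k f ->
  is_lim (unfolded_slope c k f) p_infty (end_slope c k).
Proof.
  intros hk h3 hb hf.
  eapply is_lim_ext_loc; [|apply (is_lim_sqrt_slope_sqr c k f); try assumption;
    apply is_lim_flux_ratio; first [assumption | apply hf]].
  exists 0. intros x hx. apply sqrt_pow2.
  assert (hx0 : x <> 0) by lra.
  pose proof (unfolded_slope_sign _ _ _ x hk h3 hb hf hx0). nra.
Qed.

Lemma is_lim_unfolded_slope_m c k f :
  0 < k -> 0 < c - 3 * k^2 -> 0 < c - k^2 -> solitary_wave_profile c k f ->
  is_lim (unfolded_slope c k f) m_infty (- end_slope c k).
Proof.
  intros hk h3 hb hf.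
  apply (is_lim_ext_loc (fun x => - sqrt ((unfolded_slope c k f x)^2))).
  - exists 0. intros x hx.
    assert (hx0 : x <> 0) by lra.
    pose proof (unfolded_slope_sign _ _ _ x hk h3 hb hf hx0).
    replace ((unfolded_slope c k f x)^2) with ((- unfolded_slope c k f x)^2)
      by ring.
    rewrite sqrt_pow2; [ring | nra].
  - apply (is_lim_opp _ _ (end_slope c k)), is_lim_sqrt_slope_sqr; try assumption.
    apply is_lim_flux_ratio; first [assumption | apply hf].
Qed.

Lemma is_lim_Q_primitive (s w : R -> R) (e : Rbar) (l : R) :
  is_lim s e 1 -> is_lim w e l -> 0 < 2 + l ->
  is_lim (fun x => Q_primitive (s x) (w x)) e (4 * ln (2 + l) - 2 * l).
Proof.
  intros hs hw hl. unfold Q_primitive.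
  apply is_lim_minus'.
  - apply (is_lim_comp_continuous (fun x => 1 + s x + w x)
             (fun y => 4 * ln y)).
    + apply is_lim_plus'; [|exact hw].
      apply is_lim_plus'; [apply is_lim_const | exact hs].
    + apply continuous_of_ex_derive. auto_derive. easy.
  - apply (is_lim_comp_continuous w (fun y => 2 * y)); [exact hw|].
    apply continuous_of_ex_derive. auto_derive. easy.
Qed.

Lemma end_slope_bounds c k : 0 < k -> 0 < c - 3 * k^2 -> 0 < c - k^2 ->
  0 < end_slope c k < 2.
Proof.
  intros hk h3 hb. unfold end_slope. split.
  - apply sqrt_lt_R0, Rdiv_lt_0_compat; lra.
  - rewrite <- (sqrt_pow2 2) by lra. apply sqrt_lt_1_alt. split.
    + apply Rlt_le, Rdiv_lt_0_compat; lra.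
    + apply Rlt_div_l; nra.
Qed.

(** [Q_primitive] at [s = 1], [w = W], minus the same at [s = 1], [w = -W]. *)
Definition Q_value (W : R) : R := 4 * ln (2 + W) - 4 * ln (2 - W) - 4 * W.

Lemma is_RInt_gen_Q_integrand c k f :
  0 < k -> 0 < c - 3 * k^2 -> 0 < c - k^2 -> solitary_wave_profile c k f ->
  is_RInt_gen (Q_integrand c k f) (Rbar_locally m_infty) (Rbar_locally p_infty)
    (Q_value (end_slope c k)).
Proof.
  intros hk h3 hb hf.
  pose proof (end_slope_bounds c k hk h3 hb) as hW.
  replace (Q_value (end_slope c k))
    with ((4 * ln (2 + end_slope c k) - 2 * end_slope c k)
          - (4 * ln (2 + - end_slope c k) - 2 * - end_slope c k))
    by (unfold Q_value, Rminus; ring).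
  eapply is_RInt_gen_antiderivative.
  - intros x. apply is_derive_Q_primitive; eassumption.
  - intros x.
    apply (continuous_ext (fun y => (1 - flux_ratio c k f y)^2 / flux_ratio c k f y)).
    { intros y. symmetry. apply Q_integrand_flux_ratio; assumption. }
    pose proof (is_derive_flux_ratio_of_profile _ _ _ x hb hf) as hs.
    pose proof (flux_ratio_pos _ _ _ x hk hb hf) as hs0.
    apply continuous_of_ex_derive. auto_derive.
    repeat split; try (eexists; exact hs). lra.
  - apply is_lim_Q_primitive; [| apply is_lim_unfolded_slope_m; assumption | lra].
    apply is_lim_flux_ratio; first [assumption | apply hf].
  - apply is_lim_Q_primitive; [| apply is_lim_unfolded_slope_p; assumption | lra].
    apply is_lim_flux_ratio; first [assumption | apply hf].
Qed.

(** * Dependence on the background *)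

Lemma is_derive_end_slope c k : 0 < k -> 0 < c - 3 * k^2 -> 0 < c - k^2 ->
  is_derive (end_slope c) k (- (8 * k * c) / ((c - k^2)^2 * end_slope c k)).
Proof.
  intros hk h3 hb.
  pose proof (end_slope_bounds c k hk h3 hb) as hW.
  unfold end_slope in *. auto_derive.
  - repeat split; [simpl in *; lra|]. apply Rdiv_lt_0_compat; simpl in *; lra.
  - change (k * (k * 1)) with (k^2).
    unfold Rdiv, Rminus in *. field. split; lra.
Qed.

Lemma is_derive_Q_value W : 0 < W < 2 ->
  is_derive Q_value W (4 * W^2 / (4 - W^2)).
Proof.
  intros hW. unfold Q_value. auto_derive.
  - repeat split; lra.
  - field. repeat split; nra.
Qed.

Theorem lemma4p5 (c : R) (hc : 0 < c) (phi : R -> R -> R)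
  (hphi : forall k : R, background_range c k ->
            solitary_wave_profile c k (phi k)) :
  forall k : R, background_range c k ->
    Q_converges c k (phi k) /\
    ex_derive (fun k' : R => Q c k' (phi k')) k /\
    Derive (fun k' : R => Q c k' (phi k')) k < 0.
Proof.
  intros k hrange.
  assert (hint : forall k', background_range c k' ->
    is_RInt_gen (Q_integrand c k' (phi k')) (Rbar_locally m_infty)
      (Rbar_locally p_infty) (Q_value (end_slope c k'))).
  { intros k' hk'. destruct (background_range_bounds c k' hc hk') as [h1 [h2 h3]].
    apply is_RInt_gen_Q_integrand; auto. }
  destruct (background_range_bounds c k hc hrange) as [hk [h3 hb]].
  pose proof (end_slope_bounds c k hk h3 hb) as hW.
  set (W := end_slope c k) in *.
  assert (hder : is_derive (fun k' => Q c k' (phi k')) k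
    (- (8 * k * c) / ((c - k^2)^2 * W) * (4 * W^2 / (4 - W^2)))).
  { apply (is_derive_ext_loc (fun k' => Q_value (end_slope c k'))).
    - apply (filter_imp (background_range c)); [|apply background_range_open, hrange].
      intros k' hk'. symmetry. apply is_RInt_gen_unique, hint, hk'.
    - apply (is_derive_comp Q_value (end_slope c)).
      + apply is_derive_Q_value, hW.
      + apply is_derive_end_slope; assumption. }
  split; [eexists; apply hint, hrange|].
  split; [eexists; exact hder|].
  rewrite (Derive_eta _ _ _ hder).
  replace (- (8 * k * c) / ((c - k^2)^2 * W) * (4 * W^2 / (4 - W^2)))
    with (- (32 * k * c * W / ((c - k^2)^2 * (4 - W^2)))).
  - apply Ropp_lt_gt_0_contravar, Rdiv_lt_0_compat.
    + repeat apply Rmult_lt_0_compat; lra.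
    + apply Rmult_lt_0_compat; nra.
  - field. repeat split; nra.
Qed.
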